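(* Let $1\le n\le N$ and $1\le k\le n$, let $\mathcal{A}\subseteq\{0,1,\ldots,N\}$, and let $s\in\mathbb{C}$ with $\mathrm{Re}(s)\ge 0$ (such that the inverses displayed below exist). Then $$\widetilde{\mathbf C}_{\mathcal{A}}^{n,n-k}(s)=\widetilde{\mathbf C}_{\mathcal{A}}^{n,n-1}(s)\,\widetilde{\mathbf C}_{\mathcal{A}}^{n-1,n-2}(s)\cdots\widetilde{\mathbf C}_{\mathcal{A}}^{n-k+1,n-k}(s),$$ where $$\widetilde{\mathbf C}_{\mathcal{A}}^{N,N-1}(s)=-\left(\mathbf Q^{[N,N]}-s\,\mathbf C_N\, I(N\in\mathcal{A})\right)^{-1}\mathbf Q^{[N,N-1]},$$ and for $m=N-1,\ldots,n-k+1$, $$\widetilde{\mathbf C}_{\mathcal{A}}^{m,m-1}(s)=-\left(\mathbf Q^{[m,m]}-s\,\mathbf C_m\, I(m\in\mathcal{A})+\mathbf Q^{[m,m+1]}\,\widetilde{\mathbf C}_{\mathcal{A}}^{m+1,m}(s)\right)^{-1}\mathbf Q^{[m,m-1]}.$$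
   Context: Level-dependent quasi-birth-and-death process (LD-QBD): a continuous-time Markov chain $\{(X(t),\varphi(t)):t\ge 0\}$ on the finite state space $\mathcal{S}=\{(n,i): n=0,1,\ldots,N;\ i=0,1,\ldots,K_n\}$, with level $X(t)$ and phase $\varphi(t)$, such that each transition changes the level by at most one. Its generator $\mathbf Q$ has off-diagonal entries the transition rates $q_{(n,i)\to(n',j)}$ and diagonal entries $q_{(n,i)\to(n,i)}=-\sum_{(n',j)\ne(n,i)}q_{(n,i)\to(n',j)}$. It is block tridiagonal with blocks $\mathbf Q^{[n,n']}=[q_{(n,i)\to(n',j)}]_{i=0,\ldots,K_n;\,j=0,\ldots,K_{n'}}$, which are zero if $|n-n'|>1$ and may depend on $n$. Costs accrue at rate $c(n,i)\ge 0$ per unit time in state $(n,i)$; $\mathbf C_n=\mathrm{diag}(c(n,i))_{i}$. $I(\cdot)$ is the indicator ($1$ if the condition is true, $0$ otherwise). For a set of levels $\mathcal{A}\subseteq\{0,\ldots,N\}$, $$C_{\mathcal{A}}(t)=\int_0^t c(X(u),\varphi(u))\,I(X(u)\in\mathcal{A})\,du$$ is the total cost accumulated in $\mathcal A$ up to time $t$. The first hitting time of level $m$ is $\theta_m=\inf\{t>0: X(t)=m\}$. For $1\le k\le n$, $\widetilde{\mathbf C}_{\mathcal{A}}^{n,n-k}(s)=[\widetilde C_{\mathcal{A};ij}^{n,n-k}(s)]_{i=0,\ldots,K_n;\,j=0,\ldots,K_{n-k}}$ is the matrix of Laplace–Stieltjes transforms $$\widetilde C_{\mathcal{A};ij}^{n,n-k}(s)=\int_{0}^{\infty}e^{-sz}\,c^{n,n-k}_{\mathcal{A};i,j}(z)\,dz,$$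 $$c^{n,n-k}_{\mathcal{A};i,j}(z)=\frac{\partial}{\partial z}\mathbb P\big(C_{\mathcal{A}}(\theta_{n-k})\le z,\ \varphi(\theta_{n-k})=j\mid X(0)=n,\varphi(0)=i\big),$$ where the density is understood in the generalized sense (the distribution may have an atom at $0$), i.e. $\widetilde C_{\mathcal{A};ij}^{n,n-k}(s)=\mathbb E\big[e^{-sC_{\mathcal{A}}(\theta_{n-k})}I(\theta_{n-k}<\infty,\varphi(\theta_{n-k})=j)\mid X(0)=n,\varphi(0)=i\big]$. *)

(* Defs.v *)
From HB Require Import structures.
From mathcomp Require Import all_boot all_order all_algebra.
From mathcomp Require Import complex.
From mathcomp Require Import all_classical all_reals all_analysis.

Set Implicit Arguments.
Unset Strict Implicit.
Unset Printing Implicit Defensive.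

Import Order.TTheory GRing.Theory Num.Theory.
Import numFieldNormedType.Exports.

Local Open Scope classical_set_scope.
Local Open Scope ring_scope.
Local Open Scope complex_scope.

(* [P x] is the law of the process conditioned on [Z 0 = x]; [Z] is only
   constrained at times t >= 0.  The states occupied at the epochs t 0 < t 1 < ...
   are prescribed by [z], and the Markov property is written in product form, so
   that no conditioning on a null event occurs. *)
Record is_CTMC d (Omega : measurableType d) (R : realType) (S : finType)
    (q : S -> S -> R) (P : S -> probability Omega R) (Z : R -> Omega -> S) :
    Prop := IsCTMC {
  ctmc_measurable : forall (t : R) (x : S), 0 <= t ->
    measurable [set w | Z t w = x];
  ctmc_right_continuous : forall (w : Omega) (t : R), 0 <= t ->
    \forall u \near t^'+, Z u w = Z t w;
  ctmc_start : forall x : S, P x [set w | Z 0 w = x] = 1%E;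
  ctmc_markov : forall (x : S) (k : nat) (t : nat -> R) (z : nat -> S),
    0 <= t 0%N ->
    (forall i : nat, (i <= k)%N -> t i < t i.+1) ->
    P x [set w | forall i : nat, (i <= k.+1)%N -> Z (t i) w = z i] =
    (P x [set w | forall i : nat, (i <= k)%N -> Z (t i) w = z i] *
     P (z k) [set w | Z (t k.+1 - t k)%R w = z k.+1])%E;
  ctmc_rates : forall x y : S,
    (fine (P x [set w | Z h w = y]) - (x == y)%:R) / h @[h --> 0^'+] --> q x y
}.

Section LDQBD.
Context (N : nat) (K : 'I_N.+1 -> nat).

Definition state : finType := {n : 'I_N.+1 & 'I_(K n).+1}.
Definition st (n : 'I_N.+1) (i : 'I_(K n).+1) : state :=
  Tagged (fun n => 'I_(K n).+1) i.
Definition level (x : state) : 'I_N.+1 := tag x.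
(* as a number: the type of the phase depends on the level *)
Definition phase (x : state) : nat := tagged x.

(* meaningful for m <= N only *)
Definition lev (m : nat) : 'I_N.+1 := inord m.

Record is_LDQBD_generator (R : realType) (q : state -> state -> R) : Prop :=
  IsLDQBDGenerator {
  rate_ge0 : forall x y, x != y -> 0 <= q x y;
  rate_diag : forall x, q x x = - \sum_(y | y != x) q x y;
  rate_skip_free : forall x y,
    (level x + 1 < level y)%N || (level y + 1 < level x)%N -> q x y = 0
}.

Definition Qblock (R : realType) (q : state -> state -> R) (a b : 'I_N.+1) :
    'M[R[i]]_((K a).+1, (K b).+1) :=
  \matrix_(i, j) (q (st i) (st j))%:C.

Definition Cblock (R : realType) (c : state -> R) (a : 'I_N.+1) :
    'M[R[i]]_((K a).+1) :=
  diag_mx (\row_i (c (st i))%:C).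

Definition Ind (R : realType) (A : {set 'I_N.+1}) (a : 'I_N.+1) : R[i] :=
  (a \in A)%:R.

Section Process.
Context d (Omega : measurableType d) (R : realType).
Context (P : state -> probability Omega R) (Z : R -> Omega -> state).
Context (c : state -> R) (A : {set 'I_N.+1}).

Definition total_cost (t : R) (w : Omega) : R :=
  \int[lebesgue_measure]_(u in `[0, t])
     (c (Z u w) * (level (Z u w) \in A)%:R).

Definition hitting_time (m : 'I_N.+1) (w : Omega) : \bar R :=
  ereal_inf [set t%:E | t in [set t : R | 0 < t /\ level (Z t w) = m]].

Definition cexp (z : R[i]) : R[i] :=
  (expR (complex.Re z))%:C * (cos (complex.Im z) +i* sin (complex.Im z)).

Definition cexpectation (p : probability Omega R) (f : Omega -> R[i]) : R[i] :=
  fine ('E_p[fun w => complex.Re (f w)]) +i*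
  fine ('E_p[fun w => complex.Im (f w)]).

Definition LST (s : R[i]) (a b : 'I_N.+1) : 'M[R[i]]_((K a).+1, (K b).+1) :=
  \matrix_(i, j) cexpectation (P (st i)) (fun w =>
    let theta := hitting_time b w in
    cexp (- s * (total_cost (fine theta) w)%:C) *
    (`[< (theta < +oo)%E /\ phase (Z (fine theta) w) = j >])%:R).

End Process.
End LDQBD.

(* M (n-1) *m M (n-2) *m ... *m M l for l < n, the factor M m going from index
   m.+1 to index m.  Recursing on n with l free avoids dimension casts; the base
   case, reached only at n = l when started from l <= n, is [pid_mx] between equal
   dimensions, i.e. the identity. *)
Fixpoint descending_prod (F : fieldType) (dim : nat -> nat)
    (M : forall m : nat, 'M[F]_(dim m.+1, dim m)) (n l : nat) :
    'M[F]_(dim n, dim l) :=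
  match n with
  | 0 => pid_mx (dim l)
  | n'.+1 => if (n' < l)%N then pid_mx (dim l)
             else M n' *m descending_prod M n' l
  end.

(* Main.v *)
Require Import Defs.
From HB Require Import structures.
From mathcomp Require Import all_boot all_order all_algebra.
From mathcomp Require Import complex ring lra zify.
From mathcomp Require Import all_classical all_reals all_analysis.
From mathcomp Require Import measurable_realfun.

Set Implicit Arguments.
Unset Strict Implicit.
Unset Printing Implicit Defensive.

Import Order.TTheory GRing.Theory Num.Theory.
Import numFieldNormedType.Exports.

Local Open Scope ring_scope.
Local Open Scope complex_scope.

(* For a fixed target level b, let F(x) be the transform for the chain started in x
   and ended in a prescribed state of level b, with F replaced on level b itself by
   the indicator of that state.  Then the generator annihilates F up to the
   discount: sum_y q(x,y) F(y) = s a(x) F(x) off level b, where a = c * 1_A.  To see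
   this without the strong Markov property, sample the path on the grid of mesh
   h = 1/(n+1): the first grid epoch spent in level b and the right-endpoint Riemann
   sum of the cost give a functional of a discrete-time chain, whose mean satisfies
   an exact one-step recursion by the finite-dimensional Markov property.  Since
   the paths are right-continuous step functions, the sampled functionals converge
   along every path, so the recursion divided by h converges to the equation.
   Both the product formula and the recursion for the factors then follow from
   these equations by block Gaussian elimination from level N downwards, for which
   the assumed invertibility is exactly what is needed. *)

(** * Componentwise limits of complex sequences *)

Section ComponentwiseLimits.
Local Open Scope classical_set_scope.
Context (R : realType).
Implicit Types (x y : R[i]) (u v : nat -> R[i]).

Lemma Re_add x y : complex.Re (x + y) = complex.Re x + complex.Re y.
Proof. by case: x y => [? ?] []. Qed.

Lemma Im_add x y : complex.Im (x + y) = complex.Im x + complex.Im y.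
Proof. by case: x y => [? ?] []. Qed.

Lemma Re_mul x y :
  complex.Re (x * y) = complex.Re x * complex.Re y - complex.Im x * complex.Im y.
Proof. by case: x y => [? ?] []. Qed.

Lemma Im_mul x y :
  complex.Im (x * y) = complex.Re x * complex.Im y + complex.Im x * complex.Re y.
Proof. by case: x y => [? ?] []. Qed.

(** Convergence is componentwise because [cexpectation] is: real limit theorems then apply to each
    part separately. *)
Definition complex_cvg u x : Prop :=
  (complex.Re (u n) @[n --> \oo] --> complex.Re x) /\
  (complex.Im (u n) @[n --> \oo] --> complex.Im x).

Lemma complex_cvg_cst x : complex_cvg (fun=> x) x.
Proof. by split; apply: cvg_cst. Qed.

Lemma complex_cvgD u v x y : complex_cvg u x -> complex_cvg v y ->
  complex_cvg (fun n => u n + v n) (x + y).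
Proof.
move=> [u1 u2] [v1 v2]; split.
  rewrite Re_add; under eq_fun do rewrite Re_add; exact: cvgD.
rewrite Im_add; under eq_fun do rewrite Im_add; exact: cvgD.
Qed.

Lemma complex_cvgM u v x y : complex_cvg u x -> complex_cvg v y ->
  complex_cvg (fun n => u n * v n) (x * y).
Proof.
move=> [u1 u2] [v1 v2]; split.
  rewrite Re_mul; under eq_fun do rewrite Re_mul.
  by apply: cvgB; apply: cvgM.
rewrite Im_mul; under eq_fun do rewrite Im_mul.
by apply: cvgD; apply: cvgM.
Qed.

Lemma complex_cvg_sum (I : finType) (u : I -> nat -> R[i]) (l : I -> R[i]) :
  (forall i, complex_cvg (u i) (l i)) ->
  complex_cvg (fun n => \sum_i u i n) (\sum_i l i).
Proof.
move=> ul; elim: (index_enum I) => [|i r IHr].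
  rewrite big_nil; under eq_fun do rewrite big_nil; exact: complex_cvg_cst.
rewrite big_cons; under eq_fun do rewrite big_cons; exact: complex_cvgD.
Qed.

Lemma complex_cvg_real (u : nat -> R) (l : R) :
  u n @[n --> \oo] --> l -> complex_cvg (fun n => (u n)%:C) l%:C.
Proof. by move=> ul; split => //=; apply: cvg_cst. Qed.

Lemma complex_cvg_unique u x y : complex_cvg u x -> complex_cvg u y -> x = y.
Proof.
case: x y => [x1 x2] [y1 y2] [/= ux1 ux2] [/= uy1 uy2].
by congr (_ +i* _); [exact: (cvg_unique _ ux1 uy1) | exact: (cvg_unique _ ux2 uy2)].
Qed.

Lemma complex_cvg_near u v x : (\forall n \near \oo, u n = v n) ->
  complex_cvg u x -> complex_cvg v x.
Proof.
move=> uv [u1 u2]; split.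
  apply: cvg_trans u1; apply: near_eq_cvg; apply: filterS uv => n <- //.
apply: cvg_trans u2; apply: near_eq_cvg; apply: filterS uv => n <- //.
Qed.

Lemma complex_cvg_shift (n0 : nat) (u : nat -> R[i]) (l : R[i]) :
  complex_cvg (fun n => u (n + n0)%N) l <-> complex_cvg u l.
Proof.
have E1 := cvg_shiftn n0 (fun n => complex.Re (u n)) (nbhs (complex.Re l)).
have E2 := cvg_shiftn n0 (fun n => complex.Im (u n)) (nbhs (complex.Im l)).
by split=> -[]; [rewrite /complex_cvg -E1 -E2|rewrite -E1 -E2].
Qed.

Lemma Re_cexp x : complex.Re (cexp x) = expR (complex.Re x) * cos (complex.Im x).
Proof. by rewrite /cexp Re_mul /= mul0r subr0. Qed.

Lemma Im_cexp x : complex.Im (cexp x) = expR (complex.Re x) * sin (complex.Im x).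
Proof. by rewrite /cexp Im_mul /= mul0r addr0. Qed.

Lemma cexpD x y : cexp (x + y) = cexp x * cexp y.
Proof.
apply/eqP; rewrite eq_complex /cexp !(Re_mul, Im_mul, Re_add, Im_add) /=.
by rewrite expRD cosD sinD; apply/andP; split; apply/eqP; ring.
Qed.

Lemma cexp0 : cexp 0 = 1 :> R[i].
Proof.
by rewrite /cexp /= expR0 cos0 sin0 mul1r.
Qed.

(** The squared modulus is real-valued and exactly multiplicative, so the bound by 1 passes through
    products of discounts without square roots. *)
Definition sqnorm x : R := complex.Re x ^+ 2 + complex.Im x ^+ 2.

Lemma sqnorm_ge0 x : 0 <= sqnorm x.
Proof. by rewrite addr_ge0 // sqr_ge0. Qed.

Lemma sqnormM x y : sqnorm (x * y) = sqnorm x * sqnorm y.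
Proof. rewrite /sqnorm Re_mul Im_mul; ring. Qed.

Lemma sqnorm_cexp x : complex.Re x <= 0 -> sqnorm (cexp x) <= 1.
Proof.
move=> x0; rewrite /cexp sqnormM /sqnorm /= cos2Dsin2 mulr1 expr0n addr0.
rewrite expr2 -expRD -expR0 ler_expR; lra.
Qed.

Lemma sqnorm_le1 x : sqnorm x <= 1 ->
  (`|complex.Re x| <= 1) /\ (`|complex.Im x| <= 1).
Proof.
move=> x1; have := sqr_ge0 (complex.Re x); have := sqr_ge0 (complex.Im x).
rewrite /sqnorm in x1 => h1 h2.
split; rewrite -(@expr_le1 _ 2)// -normrX ger0_norm; lra.
Qed.

Lemma complex_cvg_cexp u x : complex_cvg u x ->
  complex_cvg (fun n => cexp (u n)) (cexp x).
Proof.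
move=> [u1 u2]; apply: complex_cvgM.
  by apply: complex_cvg_real; apply: (continuous_cvg _ _ u1); apply: continuous_expR.
split => /=.
  by apply: (continuous_cvg _ _ u2); apply: continuous_cos.
by apply: (continuous_cvg _ _ u2); apply: continuous_sin.
Qed.

Lemma is_derive0_seq (f : R -> R) (l : R) (h : nat -> R) :
  is_derive (0 : R) 1 f l ->
  (forall n, 0 < h n) -> h n @[n --> \oo] --> (0 : R) ->
  (h n)^-1 * (f (h n) - f 0) @[n --> \oo] --> l.
Proof.
move=> [df <-] h0 hh.
(* The derivative is a limit over punctured neighbourhoods, and [h n] never equals 0. *)
have h_dnbhs : h n @[n --> \oo] --> (0 : R)^'.
  move=> B B0; have B1 : \forall n \near \oo, h n != 0 -> B (h n) := hh _ B0.
  by apply: filterS B1 => n; apply; rewrite gt_eqF.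
have := cvg_comp _ _ h_dnbhs df; apply: cvg_trans; apply: near_eq_cvg.
by apply: nearW => n /=; rewrite addr0 /GRing.scale /= mulr1.
Qed.

(** Both parts of [cexp (x * t)] are differentiable in the real variable t, and their derivatives at
    0 are the parts of x. *)
Lemma complex_cvg_cexp_slope x (h : nat -> R) :
  (forall n, 0 < h n) -> h n @[n --> \oo] --> (0 : R) ->
  complex_cvg (fun n => (h n)^-1%:C * (cexp (x * (h n)%:C) - 1)) x.
Proof.
case: x => [x1 x2] h0 hh; split.
  have D : is_derive (0 : R) 1 (fun t => expR (x1 * t) * cos (x2 * t)) x1.
    apply: is_derive_eq.
    rewrite !mulr0 expR0 cos0 sin0.
    rewrite /GRing.scale /=. ring.
  have := is_derive0_seq D h0 hh; apply: cvg_trans; apply: near_eq_cvg.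
  apply: nearW => n; rewrite Re_mul Re_add Re_cexp Re_mul Im_mul /=.
  by rewrite !mulr0 expR0 cos0 mul0r !subr0 add0r mul1r.
have D : is_derive (0 : R) 1 (fun t => expR (x1 * t) * sin (x2 * t)) x2.
  apply: is_derive_eq.
  rewrite !mulr0 expR0 cos0 sin0.
  rewrite /GRing.scale /=. ring.
have := is_derive0_seq D h0 hh; apply: cvg_trans; apply: near_eq_cvg.
apply: nearW => n; rewrite Im_mul Im_add Im_cexp Re_mul Im_mul /=.
by rewrite !mulr0 sin0 mul0r !subr0 addr0 add0r mulr0 subr0.
Qed.

End ComponentwiseLimits.

(** * Complex expectations *)

Section ComplexExpectation.
Local Open Scope classical_set_scope.
Context d (Omega : measurableType d) (R : realType) (p : probability Omega R).
Implicit Types (f g : Omega -> R[i]) (A : set Omega).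

Definition bounded_measurable f : Prop :=
  [/\ measurable_fun setT (fun w => complex.Re (f w)),
      measurable_fun setT (fun w => complex.Im (f w))
    & exists B : R, forall w,
        `|complex.Re (f w)| <= B /\ `|complex.Im (f w)| <= B].

Lemma bounded_measurable_cst (k : R[i]) : bounded_measurable (fun=> k).
Proof.
split; try exact: measurable_cst.
by exists (`|complex.Re k| + `|complex.Im k|) => w; rewrite lerDl lerDr.
Qed.

Lemma bounded_measurableD f g : bounded_measurable f -> bounded_measurable g ->
  bounded_measurable (fun w => f w + g w).
Proof.
move=> [f1 f2 [B fB]] [g1 g2 [C gC]]; split.
- by under eq_fun do rewrite Re_add; exact: measurable_funD.
- by under eq_fun do rewrite Im_add; exact: measurable_funD.
exists (B + C) => w; have [? ?] := fB w; have [? ?] := gC w.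
by rewrite Re_add Im_add; split; apply: (le_trans (ler_normD _ _)); exact: lerD.
Qed.

Lemma bounded_measurableM f g : bounded_measurable f -> bounded_measurable g ->
  bounded_measurable (fun w => f w * g w).
Proof.
move=> [f1 f2 [B fB]] [g1 g2 [C gC]]; split.
- under eq_fun do rewrite Re_mul.
  by apply: measurable_funB; exact: measurable_funM.
- under eq_fun do rewrite Im_mul.
  by apply: measurable_funD; exact: measurable_funM.
exists (B * C + B * C) => w; have [? ?] := fB w; have [? ?] := gC w.
rewrite Re_mul Im_mul; split.
  by apply: (le_trans (ler_normB _ _)); rewrite !normrM; apply: lerD; exact: ler_pM.
by apply: (le_trans (ler_normD _ _)); rewrite !normrM; apply: lerD; exact: ler_pM.
Qed.

Lemma bounded_measurable_sum (I : finType) (f : I -> Omega -> R[i]) :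
  (forall i, bounded_measurable (f i)) ->
  bounded_measurable (fun w => \sum_i f i w).
Proof.
move=> bmf; elim: (index_enum I) => [|i r IHr].
  by under eq_fun do rewrite big_nil; exact: bounded_measurable_cst.
by under eq_fun do rewrite big_cons; exact: bounded_measurableD.
Qed.

Lemma bounded_measurable_indic A : measurable A ->
  bounded_measurable (fun w => (w \in A)%:R).
Proof.
move=> mA; have E w : ((w \in A)%:R : R[i]) = (\1_A w)%:C.
  by rewrite indicE; case: (w \in A).
under eq_fun do rewrite E.
split => /=; [exact: measurable_indic|exact: measurable_cst|].
by exists 1 => w /=; rewrite normr0 indicE; case: (w \in A); rewrite ?normr1 ?normr0.
Qed.

Lemma bounded_measurable_integrable f : bounded_measurable f ->
  p.-integrable setT (EFin \o (fun w => complex.Re (f w))) /\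
  p.-integrable setT (EFin \o (fun w => complex.Im (f w))).
Proof.
move=> [f1 f2 [B fB]].
have pT : (p setT < +oo)%E by rewrite probability_setT ltry.
split; apply: measurable_bounded_integrable => //.
  by exists B; split; [exact: num_real|] => M BM w _ /=;
     apply: le_trans (ltW BM); case: (fB w).
by exists B; split; [exact: num_real|] => M BM w _ /=;
     apply: le_trans (ltW BM); case: (fB w).
Qed.

Lemma cexpectationE f : cexpectation p f =
  Rintegral p setT (fun w => complex.Re (f w)) +i*
  Rintegral p setT (fun w => complex.Im (f w)).
Proof. by rewrite /cexpectation unlock. Qed.

Lemma cexpectationD f g : bounded_measurable f -> bounded_measurable g ->
  cexpectation p (fun w => f w + g w) = cexpectation p f + cexpectation p g.
Proof.
move=> /bounded_measurable_integrable[f1 f2] /bounded_measurable_integrable[g1 g2].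
rewrite !cexpectationE; apply/eqP; rewrite eq_complex Re_add Im_add /=.
under eq_Rintegral do rewrite Re_add; rewrite RintegralD// eqxx /=.
by under eq_Rintegral do rewrite Im_add; rewrite RintegralD// eqxx /=.
Qed.

Lemma cexpectationZ (k : R[i]) f : bounded_measurable f ->
  cexpectation p (fun w => k * f w) = k * cexpectation p f.
Proof.
move=> /bounded_measurable_integrable[f1 f2].
have Z (r : R) (h : Omega -> R) : p.-integrable setT (EFin \o h) ->
    p.-integrable setT (EFin \o (fun w => r * h w)).
  by move=> ih; exact: (integrableZl measurableT r ih).
rewrite !cexpectationE; apply/eqP; rewrite eq_complex Re_mul Im_mul /=.
under eq_Rintegral do rewrite Re_mul.
rewrite RintegralB ?RintegralZl ?eqxx //=; try exact: Z.
under eq_Rintegral do rewrite Im_mul.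
by rewrite RintegralD ?RintegralZl ?eqxx //=; exact: Z.
Qed.

Lemma cexpectation_sum (I : finType) (f : I -> Omega -> R[i]) :
  (forall i, bounded_measurable (f i)) ->
  cexpectation p (fun w => \sum_i f i w) = \sum_i cexpectation p (f i).
Proof.
move=> bmf; suff [//] :
  cexpectation p (fun w => \sum_i f i w) = \sum_i cexpectation p (f i) /\
  bounded_measurable (fun w => \sum_i f i w).
elim: (index_enum I) => [|i r [IHr bmr]].
  under eq_fun do rewrite big_nil; split; last exact: bounded_measurable_cst.
  by rewrite big_nil cexpectationE /= !Rintegral_cst // !mul0r.
under eq_fun do rewrite big_cons; split; last exact: bounded_measurableD.
by rewrite cexpectationD // IHr big_cons.
Qed.

Lemma cexpectation_indic A : measurable A ->
  cexpectation p (fun w => (w \in A)%:R) = (fine (p A))%:C.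
Proof.
move=> mA; have E w : ((w \in A)%:R : R[i]) = (\1_A w)%:C.
  by rewrite indicE; case: (w \in A).
under eq_fun do rewrite E.
rewrite cexpectationE /= Rintegral_cst // mul0r.
by rewrite /Rintegral integral_indic // setIT.
Qed.

(** The two integrands differ only on the complement of [A], which is a null set. *)
Lemma cexpectation_restrict A f : measurable A -> p A = 1%E ->
  bounded_measurable f ->
  cexpectation p f = cexpectation p (fun w => (w \in A)%:R * f w).
Proof.
move=> mA pA bmf; have [m1 m2 _] := bounded_measurableM (bounded_measurable_indic mA) bmf.
have [f1 f2 _] := bmf.
have aeA (h k : Omega -> \bar R) : (forall w, w \in A -> h w = k w) ->
    ae_eq p setT h k.
  move=> hk; exists (~` A); split; first exact: measurableC.
    by have := probability_setC p mA; rewrite pA subee.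
  by move=> w /= hkw Aw; apply: hkw => _; apply: hk; rewrite inE.
rewrite !cexpectationE; congr (_ +i* _); congr fine; apply: ae_eq_integral => //.
- exact/measurable_EFinP.
- exact/measurable_EFinP.
- by apply: aeA => w wA; rewrite wA mul1r.
- exact/measurable_EFinP.
- exact/measurable_EFinP.
- by apply: aeA => w wA; rewrite wA mul1r.
Qed.

Lemma expectation_bounded_cvg (f : nat -> Omega -> R) (g : Omega -> R) :
  (forall n, measurable_fun setT (f n)) -> (forall n w, `|f n w| <= 1) ->
  (forall w, f n w @[n --> \oo] --> g w) ->
  Rintegral p setT (f n) @[n --> \oo] --> Rintegral p setT g.
Proof.
move=> mf f1 fg; have mg : measurable_fun setT g.
  by apply: (measurable_fun_cvg mf) => w _; exact: fg.
have [] := @dominated_convergence _ _ _ p setT measurableT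
  (fun n => EFin \o f n) (EFin \o g) (cst 1%E).
- by move=> n; exact/measurable_EFinP.
- exact/measurable_EFinP.
- by apply: aeW => w _; apply: cvg_EFin (fg w); exact: nearW.
- exact: finite_measure_integrable_cst.
- by apply: aeW => w n _; rewrite /= lee_fin.
move=> ig _ cv; rewrite /Rintegral; apply: fine_cvg.
rewrite fineK; last exact: (integrable_fin_num measurableT ig).
exact: cv.
Qed.

(** Dominated convergence in each component, with the constant 1 as dominating function. Bounded
    measurability of the limit is returned as well, so that limits can be taken twice: first in the
    number of steps, then in the mesh. *)
Lemma cexpectation_cvg (f : nat -> Omega -> R[i]) g :
  (forall n, bounded_measurable (f n)) -> (forall n w, sqnorm (f n w) <= 1) ->
  (forall w, complex_cvg (f^~ w) (g w)) ->
  bounded_measurable g /\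
  complex_cvg (fun n => cexpectation p (f n)) (cexpectation p g).
Proof.
move=> bmf f1 fg; split.
  split.
  - apply: (@measurable_fun_cvg _ _ _ _ (fun n w => complex.Re (f n w))).
      by move=> n; have [] := bmf n.
    by move=> w _; have [] := fg w.
  - apply: (@measurable_fun_cvg _ _ _ _ (fun n w => complex.Im (f n w))).
      by move=> n; have [] := bmf n.
    by move=> w _; have [] := fg w.
  exists 1 => w; have [fg1 fg2] := fg w.
  have cl (h : nat -> R) (l : R) : h n @[n --> \oo] --> l ->
      (forall n, `|h n| <= 1) -> `|l| <= 1.
    move=> hl h1; have nl : `|h n| @[n --> \oo] --> `|l| by exact: cvg_norm.
    by apply: (cvgr_to_le nl); exact: nearW.
  by split; [apply: cl fg1 _|apply: cl fg2 _] => n;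
    have [] := sqnorm_le1 (f1 n w).
under eq_fun do rewrite cexpectationE; rewrite cexpectationE.
split => /=.
  apply: expectation_bounded_cvg => [n|n w|w].
  - by have [] := bmf n.
  - by have [] := sqnorm_le1 (f1 n w).
  - by have [] := fg w.
apply: expectation_bounded_cvg => [n|n w|w].
- by have [] := bmf n.
- by have [] := sqnorm_le1 (f1 n w).
- by have [] := fg w.
Qed.

End ComplexExpectation.

(** * The sampled chain *)

Section Discretization.
Local Open Scope classical_set_scope.
Context (R : realType) (S : finType).
Context (e : S -> R[i]) (B : pred S) (y0 : S).

(* The chain [z] is watched at its first [M] steps: the weights [e] of the states
   entered are multiplied up to the first entrance into [B], which has to occur
   at [y0]. *)
Fixpoint chain_weight (M : nat) (z : nat -> S) : R[i] :=
  match M with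
  | 0 => 0
  | M'.+1 => e (z 1%N) * (if B (z 1%N) then (z 1%N == y0)%:R
                          else chain_weight M' (fun i => z i.+1))
  end.

(** The mean of [chain_weight] for a Markov chain with transition matrix [p] started at [x], written
    as its backward recursion. *)
Fixpoint chain_value (p : S -> S -> R) (M : nat) (x : S) : R[i] :=
  match M with
  | 0 => 0
  | M'.+1 => \sum_y (p x y)%:C * (e y * (if B y then (y == y0)%:R
                                         else chain_value p M' y))
  end.

Lemma chain_valueS p M x : chain_value p M.+1 x =
  \sum_y (p x y)%:C * (e y * (if B y then (y == y0)%:R else chain_value p M y)).
Proof. by []. Qed.

Lemma sqnorm_bool (b : bool) : sqnorm (b%:R : R[i]) <= 1.
Proof. by case: b; rewrite /sqnorm /= !expr2 ?mulr0 ?mulr1 ?addr0. Qed.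

Lemma sqnorm_chain_weight M z : (forall x, sqnorm (e x) <= 1) ->
  sqnorm (chain_weight M z) <= 1.
Proof.
move=> e1; elim: M z => [|M IHM] z /=; first exact: (sqnorm_bool false).
rewrite sqnormM mulr_ile1 ?sqnorm_ge0 //.
by case: ifP => _; [exact: sqnorm_bool|exact: IHM].
Qed.

(** Once the first entrance, at step I+1, lies within the horizon, the weight no longer depends on
    [M]. The induction shifts the path by one step. *)
Lemma chain_weight_hit (I M : nat) (z : nat -> S) : (I < M)%N ->
  B (z I.+1) -> (forall i, (i < I)%N -> ~~ B (z i.+1)) ->
  chain_weight M z = (\prod_(i < I.+1) e (z i.+1)) * (z I.+1 == y0)%:R.
Proof.
elim: I M z => [|I IHI] [//|M] z IM BI nB /=.
  by rewrite BI big_ord1.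
rewrite (negbTE (nB 0%N isT)) (IHI M (fun i => z i.+1)) //; last first.
  by move=> i iI; exact: nB i.+1 _.
by rewrite [in RHS]big_ord_recl mulrA.
Qed.

Lemma chain_weight_miss (M : nat) (z : nat -> S) :
  (forall i, ~~ B (z i.+1)) -> chain_weight M z = 0.
Proof.
elim: M z => [//|M IHM] z nB /=.
by rewrite (negbTE (nB 0%N)) IHM ?mulr0 // => i; exact: nB.
Qed.

Section Chain.
Context d (Omega : measurableType d).

Lemma bounded_measurable_chain_weight (M : nat) (Y : nat -> Omega -> S) :
  (forall i x, measurable [set w | Y i w = x]) ->
  bounded_measurable (fun w => chain_weight M (fun i => Y i w)).
Proof.
elim: M Y => [|M IHM] Y mY /=; first exact: bounded_measurable_cst.
(* Splitting over the finitely many values of [Y 1] turns the weight into a finite sum of indicators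
   times weights of a shorter horizon. *)
have -> : (fun w => e (Y 1%N w) * (if B (Y 1%N w) then (Y 1%N w == y0)%:R
                          else chain_weight M (fun i => Y i.+1 w))) =
  fun w => \sum_y (w \in [set w | Y 1%N w = y])%:R *
     (e y * (if B y then (y == y0)%:R else chain_weight M (fun i => Y i.+1 w))).
  apply/funext => w; rewrite (bigD1 (Y 1%N w)) //= big1 => [|y yY].
    by rewrite addr0 mem_set // mul1r.
  by rewrite memNset ?mul0r //= => Yy; rewrite Yy eqxx in yY.
apply: bounded_measurable_sum => y; apply: bounded_measurableM.
  exact: bounded_measurable_indic.
apply: bounded_measurableM; first exact: bounded_measurable_cst.
case: (B y); first exact: bounded_measurable_cst.
by apply: IHM => i x; exact: mY.
Qed.

Context (q : S -> S -> R) (P : S -> probability Omega R) (Z : R -> Omega -> S).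
Context (hZ : is_CTMC q P Z).

Definition transition (h : R) (x y : S) : R := fine (P x [set w | Z h w = y]).

Context (h : R).
Context (h0 : 0 < h).
Let t (i : nat) : R := h * i%:R.
Let t_ge0 i : 0 <= t i.
Proof. by rewrite mulr_ge0 // ltW. Qed.

Definition cylinder (k : nat) (z : nat -> S) : set Omega :=
  [set w | forall i, (i <= k)%N -> Z (h * i%:R) w = z i].

Lemma measurable_cylinder k z : measurable (cylinder k z).
Proof.
have -> : cylinder k z = \bigcap_(i in [set i | (i <= k)%N]) [set w | Z (t i) w = z i].
  by [].
apply: bigcap_measurable => [|i _]; first by exists 0%N.
exact: (ctmc_measurable hZ).
Qed.

(** Continues the prescribed path after epoch k by the state y, so that one more observation of a
    cylinder gives a cylinder again. *)
Let extend (z : nat -> S) (k : nat) (y : S) (i : nat) : S :=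
  if (i <= k)%N then z i else y.

Lemma cylinder_extend k z y : cylinder k.+1 (extend z k y) =
  cylinder k z `&` [set w | Z (t k.+1) w = y].
Proof.
apply/seteqP; split => w /=; rewrite /extend.
  move=> zw; split => [i ik|]; first by have := zw i (leqW ik); rewrite ik.
  by have := zw k.+1 (leqnn _); rewrite ltnn.
move=> [zw yw] i; rewrite leq_eqVlt => /orP[/eqP->|ik]; first by rewrite ltnn.
by rewrite -ltnS ik; exact: zw.
Qed.

(** The product form of the Markov property at the grid epochs, whose consecutive differences all
    equal [h]. *)
Lemma cylinder_extend_prob x k z y : P x (cylinder k.+1 (extend z k y)) =
  (P x (cylinder k z) * P (z k) [set w | Z h w = y])%E.
Proof.
have := ctmc_markov hZ x (k := k) (t := t) (extend z k y) (t_ge0 0) _.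
rewrite -/(cylinder k.+1 (extend z k y)) => ->.
  congr (P x _ * _)%E.
    apply/seteqP; split => w /= zw i ik; have := zw i ik; by rewrite /extend ik.
  rewrite /extend leqnn ltnn; congr (P _ _).
  by rewrite /t -mulrBr -natrB // subSnn mulr1.
by move=> i _; rewrite /t ltr_pM2l // ltr_nat.
Qed.

(** Induction on [M], for all [k] and [z] at once: the cylinder is split by the state at epoch k+1,
    each piece is a cylinder one step longer, and its probability factors by the Markov property.
    Multiplying by the indicator instead of conditioning also covers null cylinders. *)
Lemma cexpectation_chain_weight_cylinder x M k z :
  cexpectation (P x)
    (fun w => (w \in cylinder k z)%:R * chain_weight M (fun i => Z (t (k + i)) w)) =
  (fine (P x (cylinder k z)))%:C * chain_value (transition h) M (z k).
Proof.
elim: M k z => [|M IHM] k z.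
  under eq_fun do rewrite mulr0.
  by rewrite mulr0 cexpectationE /= !Rintegral_cst // !mul0r.
have mC y : measurable (cylinder k.+1 (extend z k y)) by exact: measurable_cylinder.
pose g y w := e y * (if B y then (y == y0)%:R * (w \in cylinder k.+1 (extend z k y))%:R
  else (w \in cylinder k.+1 (extend z k y))%:R *
       chain_weight M (fun i => Z (t (k.+1 + i)) w)).
have mW : bounded_measurable (fun w => chain_weight M (fun i => Z (t (k.+1 + i)) w)).
  by apply: bounded_measurable_chain_weight => i y; exact: (ctmc_measurable hZ).
have mg' y : bounded_measurable (fun w =>
    if B y then (y == y0)%:R * (w \in cylinder k.+1 (extend z k y))%:R
    else (w \in cylinder k.+1 (extend z k y))%:R *
       chain_weight M (fun i => Z (t (k.+1 + i)) w)).
  case: (B y); apply: bounded_measurableM => //; try exact: bounded_measurable_indic.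
  exact: bounded_measurable_cst.
have mg y : bounded_measurable (g y).
  by apply: bounded_measurableM => //; exact: bounded_measurable_cst.
have -> : (fun w => (w \in cylinder k z)%:R *
     chain_weight M.+1 (fun i => Z (t (k + i)) w)) = fun w => \sum_y g y w.
  apply/funext => w /=; rewrite addn1 (bigD1 (Z (t k.+1) w)) //= big1 ?addr0.
    rewrite /g; set y := Z _ w; rewrite cylinder_extend in_setI.
    rewrite [X in _ && X]mem_set // andbT.
    under [in LHS]eq_fun do rewrite addnS -addSn.
    by case: (B y); rewrite mulrCA //; congr (_ * _); rewrite mulrC.
  move=> y yZ; rewrite /g cylinder_extend in_setI [X in _ && X]memNset ?andbF.
    by case: ifP => _; rewrite ?mul0r !mulr0.
  by move=> /= Zy; rewrite Zy eqxx in yZ.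
rewrite chain_valueS cexpectation_sum // mulr_sumr; apply: eq_bigr => y _.
rewrite cexpectationZ //.
have Pk : (fine (P x (cylinder k.+1 (extend z k y))))%:C =
    (fine (P x (cylinder k z)))%:C * (transition h (z k) y)%:C :> R[i].
  rewrite cylinder_extend_prob fineM ?fin_num_measure //.
  - by rewrite rmorphM.
  - exact: measurable_cylinder.
  - by apply: (ctmc_measurable hZ); exact: ltW.
case: ifP => By.
  rewrite cexpectationZ ?cexpectation_indic ?Pk //; last exact: bounded_measurable_indic.
  ring.
rewrite IHM Pk {1}/extend ltnn; ring.
Qed.

Lemma cexpectation_chain_weight x M :
  cexpectation (P x) (fun w => chain_weight M (fun i => Z (h * i%:R) w)) =
  chain_value (transition h) M x.
Proof.
have c0 : cylinder 0 (fun=> x) = [set w | Z 0 w = x].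
  apply/seteqP; split => w /= zw; first by rewrite -(zw 0%N) // mulr0.
  by move=> i; rewrite leqn0 => /eqP ->; rewrite mulr0.
have P0 : P x (cylinder 0 (fun=> x)) = 1%E by rewrite c0; exact: (ctmc_start hZ).
(* Under [P x] the path starts at x almost surely, so the cylinder of length 0 has full measure. *)
rewrite (cexpectation_restrict (measurable_cylinder 0 (fun=> x)) P0); last first.
  apply: bounded_measurable_chain_weight => i y; apply: (ctmc_measurable hZ).
  exact: (t_ge0 i).
have := cexpectation_chain_weight_cylinder x M 0 (fun=> x).
by rewrite P0 mul1r; apply.
Qed.

End Chain.
End Discretization.

(** * Right-endpoint Riemann sums *)

Section RiemannSums.
Local Open Scope classical_set_scope.
Context (R : realType).

Lemma right_nbhs_dist (x : R) (Q : R -> Prop) : (\forall u \near x^'+, Q u) ->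
  Q x -> exists2 e, 0 < e & forall u, x <= u < x + e -> Q u.
Proof.
move=> /nbhs_ballP[e /= e0 he] Qx; exists e => // u /andP[].
rewrite le_eqVlt => /orP[/eqP <- //|xu ue]; apply: he => //.
by rewrite /ball /= ltr_distlC; apply/andP; split; lra.
Qed.

Lemma grid_cell (h u : R) : 0 < h -> 0 < u ->
  exists i : nat, h * i%:R < u <= h * i.+1%:R.
Proof.
move=> h0 u0; have ex : exists n : nat, u <= h * n%:R.
  exists (Num.trunc (u / h)).+1; rewrite mulrC -ler_pdivrMr // ltW //.
  exact: truncnS_gt.
case: (ex_minnP ex) => [[|i]] ui umin; first by rewrite mulr0 leNgt u0 in ui.
exists i; rewrite ui andbT ltNge; apply/negP => /umin; by rewrite ltnn.
Qed.

(** The step function whose integral is the right-endpoint Riemann sum. The cells are open on the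
    left, so each u > 0 lies in exactly one, and the sampled point is never to the left of u, as
    right-continuity requires. *)
Definition grid_step (f : R -> R) (h : R) (k : nat) (u : R) : R :=
  \sum_(i < k) f (h * i.+1%:R) * \1_(`]h * i%:R, h * i.+1%:R]) u.

Lemma grid_stepE (f : R -> R) h k u i : 0 < h -> h * i%:R < u <= h * i.+1%:R ->
  grid_step f h k u = if (i < k)%N then f (h * i.+1%:R) else 0.
Proof.
move=> h0 /andP[iu ui]; rewrite /grid_step.
have off (j : nat) : j != i -> \1_(`]h * j%:R, h * j.+1%:R]) u = 0 :> R.
  move=> ji; rewrite indicE memNset //= in_itv /= => /andP[ju uj].
  have := lt_le_trans iu uj; have := lt_le_trans ju ui.
  rewrite !ltr_pM2l // !ltr_nat !ltnS => ? ?; case/negP: ji; apply/eqP; lia.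
case: ifP => ik.
  rewrite (bigD1 (Ordinal ik)) //= big1 ?addr0 => [|j ji]; last by rewrite off ?mulr0.
  by rewrite indicE mem_set ?mulr1 //= in_itv /= iu.
rewrite big1 // => j _; rewrite off ?mulr0 //.
by apply/negP => /eqP ji; rewrite -ji ltn_ord in ik.
Qed.

Lemma measurable_grid_step (f : R -> R) h k (D : set R) : measurable_fun D (grid_step f h k).
Proof.
apply: measurable_sum => i; apply: measurable_funM; first exact: measurable_cst.
exact: measurable_indic.
Qed.

Lemma bounded_integrable_itv (g : R -> R) (C T : R) :
  measurable_fun `]0, T] g -> (forall u, `]0, T] u -> `|g u| <= C) ->
  lebesgue_measure.-integrable `]0, T] (EFin \o g).
Proof.
move=> mg gC; apply: measurable_bounded_integrable => //.
  suff : (lebesgue_measure (`]0%R, T] : set R) < +oo)%E by [].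
  by rewrite lebesgue_measure_itv /=; case: ifP => _; rewrite ?ltry // -EFinD ltry.
by exists C; split; [exact: num_real|] => M CM u uT; apply: le_trans (gC u uT) (ltW CM).
Qed.

Lemma Rintegral_grid_step (f : R -> R) h k T : 0 < h -> h * k%:R <= T ->
  Rintegral lebesgue_measure `]0, T] (grid_step f h k) =
  \sum_(i < k) f (h * i.+1%:R) * h.
Proof.
move=> h0 kT.
have mc (i : nat) : measurable_fun `]0, T] (\1_(`]h * i%:R, h * i.+1%:R]) : R -> R).
  exact: measurable_indic.
have b1 (i : nat) (u : R) : `|\1_(`]h * i%:R, h * i.+1%:R]) u : R| <= 1.
  by rewrite indicE; case: (_ \in _); rewrite ?normr1 ?normr0.
have ic (i : nat) : lebesgue_measure.-integrable `]0, T]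
    (EFin \o \1_(`]h * i%:R, h * i.+1%:R])).
  by apply: (@bounded_integrable_itv _ 1) => // u _.
have vc (i : nat) : (i < k)%N ->
    Rintegral lebesgue_measure `]0, T] \1_(`]h * i%:R, h * i.+1%:R]) = h.
  move=> ik; rewrite /Rintegral integral_indic // setIidl.
    suff : lebesgue_measure (`]h * i%:R, h * i.+1%:R] : set R) = h%:E by exact: (congr1 fine).
    rewrite lebesgue_measure_itv /= lte_fin ltr_pM2l // ltr_nat ltnSn -EFinD /=.
    by rewrite -mulrBr -natrB // subSnn mulr1.
  move=> u /=; rewrite !in_itv /= => /andP[iu ui]; apply/andP; split.
    by apply: le_lt_trans iu; rewrite mulr_ge0 // ltW.
  by apply: le_trans ui (le_trans _ kT); rewrite ler_pM2l // ler_nat.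
have il (j : nat) : (j <= k)%N ->
    lebesgue_measure.-integrable `]0, T] (EFin \o (grid_step f h j)) /\
    Rintegral lebesgue_measure `]0, T] (grid_step f h j) =
    \sum_(i < j) f (h * i.+1%:R) * h.
  elim: j => [_|j IHj jk].
    have -> : grid_step f h 0 = fun=> 0.
      by apply/funext => u; rewrite /grid_step big_ord0.
    rewrite big_ord0 Rintegral_cst // mul0r; split => //.
    by apply: (@bounded_integrable_itv _ 0) => // u _; rewrite normr0.
  have [ij vj] := IHj (ltnW jk).
  have icj : lebesgue_measure.-integrable `]0, T] (EFin \o (fun u =>
      f (h * j.+1%:R) * \1_(`]h * j%:R, h * j.+1%:R]) u)).
    exact: (integrableZl _ (f (h * j.+1%:R)) (ic j)).
  rewrite big_ord_recr /=.
  have -> : grid_step f h j.+1 = fun u =>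
      grid_step f h j u + f (h * j.+1%:R) * \1_(`]h * j%:R, h * j.+1%:R]) u.
    by apply/funext => u; rewrite /grid_step big_ord_recr.
  split; first exact: (integrableD _ ij icj).
  by rewrite RintegralD // vj RintegralZl // vc.
by have [] := il k (leqnn k).
Qed.

Lemma Rintegral_dominated_cvg (f : nat -> R -> R) (g : R -> R) (C T : R) :
  (forall n, measurable_fun `]0, T] (f n)) ->
  (forall n u, `]0, T] u -> `|f n u| <= C) ->
  (forall u, `]0, T] u -> f n u @[n --> \oo] --> g u) ->
  Rintegral lebesgue_measure `]0, T] (f n) @[n --> \oo] -->
  Rintegral lebesgue_measure `]0, T] g.
Proof.
move=> mf fC fg; have mg : measurable_fun `]0, T] g by exact: (measurable_fun_cvg mf).
have [] := @dominated_convergence _ _ _ lebesgue_measure `]0, T] (measurable_itv _)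
  (fun n => EFin \o f n) (EFin \o g) (cst C%:E).
- by move=> n; apply/measurable_EFinP; exact: mf.
- exact/measurable_EFinP.
- by apply: aeW => u uT; apply: cvg_EFin (fg u uT); exact: nearW.
- apply: (@bounded_integrable_itv (cst C) `|C|) => //.
- by apply: aeW => u n uT; rewrite /= lee_fin; exact: fC.
move=> ig _ cv; rewrite /Rintegral; apply: fine_cvg.
rewrite fineK; last exact: (integrable_fin_num _ ig).
exact: cv.
Qed.

(** The right end of the cell of u lies in [u, u + h), where [f] is constant once h is small. The
    step functions thus converge pointwise and are dominated by [C]. *)
Lemma riemann_cvg (f : R -> R) (C : R) (h : nat -> R) (k : nat -> nat) (r : R) :
  (forall u, `|f u| <= C) ->
  (forall u, 0 <= u -> \forall v \near u^'+, f v = f u) ->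
  (forall n, 0 < h n <= 1) -> h n @[n --> \oo] --> (0 : R) ->
  0 <= r -> (forall n, r <= h n * (k n)%:R <= r + h n) ->
  \sum_(i < k n) f (h n * i.+1%:R) * h n @[n --> \oo] -->
    Rintegral lebesgue_measure `[0, r] f.
Proof.
move=> fC rcf h01 hh r0 kr.
have h0 n : 0 < h n by have /andP[] := h01 n.
have hlt (e : R) : 0 < e -> \forall n \near \oo, h n < e.
  by move=> e0; exact: (cvgr_lt _ hh).
(* A fixed interval containing every grid: the last epoch is at most r + h, and h is at most 1. The
   limit [g] is cut off at r because the overshoot beyond r disappears. *)
pose D := `]0, r + 1] : set R.
pose g := f \_ `]-oo, r].
have ptcvg u : D u -> grid_step f (h n) (k n) u @[n --> \oo] --> g u.
  rewrite /D /= in_itv /= => /andP[u0 ur1]; apply: cvg_near_cst.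
  have [e e0 fe] := right_nbhs_dist (rcf u (ltW u0)) erefl.
  have [ur|ru] := leP u r.
    apply: filterS (hlt e e0) => n hne.
    have [i iu] := grid_cell (h0 n) u0.
    rewrite (grid_stepE f (k n) (h0 n) iu).
    have -> : (i < k n)%N.
      rewrite -(ltr_nat R) -(ltr_pM2l (h0 n)); move/andP: iu => [iu _].
      by apply: lt_le_trans iu (le_trans ur _); have /andP[] := kr n.
    rewrite /g patchE mem_set ?in_itv //= fe //.
    move: iu; rewrite -natr1 mulrDr mulr1 => /andP[? ?]; apply/andP; split; lra.
  (* Beyond r the step function eventually vanishes: when h < u - r, the last epoch r + h is still
     below u. *)
  have ur0 : 0 < u - r by rewrite subr_gt0.
  apply: filterS (hlt _ ur0) => n hne.
  have [i iu] := grid_cell (h0 n) u0.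
  rewrite (grid_stepE f (k n) (h0 n) iu) /g patchE memNset; last first.
    by rewrite /= in_itv /= => /le_lt_trans/(_ ru); rewrite ltxx.
  case: ifP => // ik; move: iu => /andP[_ iu].
  have : h n * i.+1%:R <= h n * (k n)%:R by rewrite ler_pM2l // ler_nat.
  have /andP[_] := kr n; lra.
have C0 : 0 <= C by apply: le_trans (fC 0).
have bd n u : D u -> `|grid_step f (h n) (k n) u| <= C.
  rewrite /D /= in_itv /= => /andP[u0 _].
  have [i iu] := grid_cell (h0 n) u0; rewrite (grid_stepE f (k n) (h0 n) iu).
  by case: ifP => _; rewrite ?normr0.
(* Measurability of [f] on ]0, r] is extracted from that of the step functions converging to it. *)
have mg : measurable_fun D g.
  by apply: (measurable_fun_cvg _ ptcvg) => n; exact: measurable_grid_step.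
have DE : D `&` `]-oo, r] = `]0, r].
  apply/seteqP; split => u; rewrite /D /= !in_itv /=.
    by move=> [/andP[-> _] ->].
  by move=> /andP[u0 ur]; rewrite u0 ur; split => //; lra.
have mf : measurable_fun `]0, r] f.
  have : measurable_fun `]0, r] g.
    by apply: measurable_funS mg; [exact: measurable_itv|rewrite -DE; exact: subIsetl].
  apply: eq_measurable_fun => u; rewrite inE /= in_itv /= => /andP[_ ur].
  by rewrite /g patchE mem_set.
have <- : Rintegral lebesgue_measure D g = Rintegral lebesgue_measure `[0, r] f.
  rewrite -Rintegral_mkcondr DE Rintegral_itv_obnd_cbnd //.
  exact: bounded_integrable_itv mf _.
have -> : (fun n => \sum_(i < k n) f (h n * i.+1%:R) * h n) =
    fun n => Rintegral lebesgue_measure D (grid_step f (h n) (k n)).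
  apply/funext => n; rewrite Rintegral_grid_step //.
  have /andP[_ kn] := kr n; have /andP[_ hn] := h01 n; lra.
apply: Rintegral_dominated_cvg bd ptcvg => n; exact: measurable_grid_step.
Qed.

End RiemannSums.

(** * Convergence along a sample path *)

Section TotalWeight.
Local Open Scope classical_set_scope.
Context (R : realType) (S : finType).
Implicit Types (e : S -> R[i]) (B : pred S) (z : nat -> S).

(** The value of [chain_weight] with unlimited horizon; paths that never enter [B] have weight 0. *)
Definition total_weight e B y0 z : R[i] :=
  if pselect (exists i, B (z i.+1)) is left zB
  then (\prod_(i < (ex_minn zB).+1) e (z i.+1)) * (z (ex_minn zB).+1 == y0)%:R
  else 0.

Lemma chain_weight_cvg e B y0 z :
  complex_cvg (fun M => chain_weight e B y0 M z) (total_weight e B y0 z).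
Proof.
apply: (@complex_cvg_near _ (fun=> total_weight e B y0 z));
  last exact: complex_cvg_cst.
rewrite /total_weight; case: pselect => [zB|nB].
  case: ex_minnP => I BI Imin; near=> M.
  rewrite (@chain_weight_hit _ _ _ _ _ I) //; first by near: M; exists I.+1.
  by move=> i iI; apply/negP => /Imin; rewrite leqNgt iI.
near=> M; rewrite chain_weight_miss // => i; apply/negP => Bi; apply: nB.
by exists i.
Unshelve. all: by end_near. Qed.

Lemma sqnorm_total_weight e B y0 z : (forall x, sqnorm (e x) <= 1) ->
  sqnorm (total_weight e B y0 z) <= 1.
Proof.
move=> e1; rewrite /total_weight; case: pselect => [zB|_]; last first.
  exact: (sqnorm_bool _ false).
rewrite sqnormM mulr_ile1 ?sqnorm_ge0 ?sqnorm_bool //.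
elim: (ex_minn zB).+1 => [|k IHk].
  by rewrite big_ord0; exact: (sqnorm_bool _ true).
by rewrite big_ord_recr sqnormM mulr_ile1 ?sqnorm_ge0.
Qed.

End TotalWeight.

Section SamplePath.
Local Open Scope classical_set_scope.
Context (R : realType) (S : finType) (z : R -> S) (B : pred S).
Context (rc : forall u, 0 <= u -> \forall v \near u^'+, z v = z u).

Definition first_entrance : \bar R :=
  ereal_inf [set t%:E | t in [set t : R | 0 < t /\ B (z t)]].

(** The infimum r runs over t > 0 and may be 0. The path is constant just after r and visits [B] at
    times arbitrarily close to r from the right, hence the state at r lies in [B]. *)
Lemma first_entrance_attained : (first_entrance < +oo)%E ->
  exists2 r : R, first_entrance = r%:E &
   [/\ 0 <= r, B (z r) & forall t, 0 < t -> B (z t) -> r <= t].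
Proof.
rewrite /first_entrance; set H := [set t%:E | t in _] => Hoo.
have lb : (0 <= ereal_inf H)%E.
  by apply: le_ereal_inf_tmp => _ [t /= [t0 _] <-]; rewrite lee_fin ltW.
have fH : ereal_inf H \is a fin_num by rewrite ge0_fin_numE.
exists (fine (ereal_inf H)); first by rewrite fineK.
set r := fine _; have rH : ereal_inf H = r%:E by rewrite fineK.
have r0 : 0 <= r by rewrite -lee_fin -rH.
have rmin t : 0 < t -> B (z t) -> r <= t.
  by move=> t0 Bt; rewrite -lee_fin -rH; apply: ereal_inf_lbound; exists t.
split => //; have [e e0 ze] := right_nbhs_dist (rc r0) erefl.
have : (ereal_inf H < (r + e)%:E)%E by rewrite rH lte_fin ltrDl.
move=> /ereal_inf_lt[_ [t /= [t0 Bt] <-]]; rewrite lte_fin => te.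
by rewrite -(ze t) // te rmin.
Qed.

Context (a : S -> R) (s : R[i]) (y0 : S).

Definition mesh (n : nat) : R := n.+1%:R^-1.

Definition step_discount (n : nat) (x : S) : R[i] := cexp (- s * (a x * mesh n)%:C).

Lemma mesh_bounds n : 0 < mesh n <= 1.
Proof. by rewrite invr_gt0 ltr0Sn invf_le1 ?ltr0Sn // ler1n. Qed.

Lemma mesh_cvg0 : mesh n @[n --> \oo] --> (0 : R).
Proof. exact: cvg_harmonic. Qed.

Lemma prod_step_discount n k (x : nat -> S) :
  \prod_(i < k) step_discount n (x i) = cexp (- s * (\sum_(i < k) a (x i) * mesh n)%:C).
Proof.
elim: k => [|k IHk]; first by rewrite !big_ord0 mulr0 cexp0.
by rewrite !big_ord_recr /= IHk /step_discount -cexpD -mulrDr -rmorphD.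
Qed.

(** If the path enters [B] at r, it keeps the state [z r] on some [r, r + e). For a mesh below e the
    first grid epoch in [B] therefore exceeds r by at most one mesh and shows [z r], and the
    exponents are Riemann sums of the cost. If the path never enters [B], both sides are 0. *)
Lemma total_weight_cvg : complex_cvg
  (fun n => total_weight (step_discount n) B y0 (fun i => z (mesh n * i%:R)))
  (cexp (- s * (Rintegral lebesgue_measure `[0, fine first_entrance]
                  (fun u => a (z u)))%:C) *
   (`[< (first_entrance < +oo)%E /\ z (fine first_entrance) = y0 >])%:R).
Proof.
have m0 n : 0 < mesh n by have /andP[] := mesh_bounds n.
have [foo|] := boolP (first_entrance < +oo)%E; last first.
  move=> foo; have -> : `[< false /\ z (fine first_entrance) = y0 >] = false.
    by apply/asboolP => -[].
  rewrite mulr0; apply: (@complex_cvg_near _ (fun=> 0)); last exact: complex_cvg_cst.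
  apply: nearW => n; rewrite /total_weight; case: pselect => // -[i Bi].
  case/negP: foo; apply: (@le_lt_trans _ _ (mesh n * i.+1%:R)%:E); last exact: ltry.
  by apply: ereal_inf_lbound; exists (mesh n * i.+1%:R) => //; split => //; rewrite mulr_gt0.
have [r -> [r0 Br rmin]] := first_entrance_attained foo; rewrite /=.
have -> : `[< true /\ z r = y0 >] = (z r == y0).
  by apply/asboolP/eqP => [[]|].
have [e e0 ze] := right_nbhs_dist (rc r0) erefl.
(* From index [n0] on the mesh is too fine to step over [r, r + e); the sequence is shifted
   accordingly. *)
have [n0 _ n0e] : \forall n \near \oo, mesh n < e by exact: (cvgr_lt _ mesh_cvg0).
apply/(@complex_cvg_shift _ n0).
have hit n : exists k : nat, [/\ r <= mesh (n + n0) * k%:R <= r + mesh (n + n0) &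
    total_weight (step_discount (n + n0)) B y0 (fun i => z (mesh (n + n0) * i%:R)) =
    cexp (- s * (\sum_(i < k) a (z (mesh (n + n0) * i.+1%:R)) * mesh (n + n0))%:C)
    * (z r == y0)%:R].
  have /= me := n0e (n + n0)%N (leq_addl _ _).
  move: (n + n0)%N me => {}n me.
  (* Weights ignore epoch 0, so for r = 0 the witness is the first epoch; otherwise it is the right
     end of the cell containing r. *)
  have [j jr] : exists j : nat, r <= mesh n * j.+1%:R <= r + mesh n.
    have [->|rN0] := eqVneq r 0; first by exists 0%N; rewrite mulr1 add0r lexx ltW.
    have [|j /andP[]] := grid_cell (m0 n) (u := r); first by rewrite lt_def rN0.
    by rewrite -natr1 => ? ?; exists j; rewrite -natr1; apply/andP; split; lra.
  have zr k : r <= mesh n * k%:R <= r + mesh n -> z (mesh n * k%:R) = z r.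
    by move=> /andP[? ?]; apply: ze; apply/andP; split; lra.
  rewrite /total_weight; case: pselect => [zB|nB]; last first.
    by case: nB; exists j; rewrite zr.
  case: ex_minnP => I BI Imin.
  have Ij : mesh n * I.+1%:R <= mesh n * j.+1%:R.
    by rewrite ler_pM2l // ler_nat ltnS; apply: Imin; rewrite zr.
  have rI : r <= mesh n * I.+1%:R <= r + mesh n.
    rewrite rmin ?mulr_gt0 //=; apply: le_trans Ij _; by have /andP[] := jr.
  by exists I.+1; rewrite rI zr // (prod_step_discount n I.+1 (fun i => z (mesh n * i.+1%:R))).
have [k hk] := choice hit.
have -> : (fun n => total_weight (step_discount (n + n0)) B y0
     (fun i => z (mesh (n + n0) * i%:R))) = fun n =>
    cexp (- s * (\sum_(i < k n) a (z (mesh (n + n0) * i.+1%:R)) * mesh (n + n0))%:C)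
    * (z r == y0)%:R.
  by apply/funext => n; have [] := hk n.
apply: complex_cvgM; last exact: complex_cvg_cst.
apply: complex_cvg_cexp; apply: complex_cvgM; first exact: complex_cvg_cst.
apply: complex_cvg_real.
apply: (@riemann_cvg _ (fun u => a (z u)) (\sum_x `|a x|)
  (fun n => mesh (n + n0)) k r) => //.
- by move=> u; rewrite (bigD1 (z u)) //= lerDl sumr_ge0.
- by move=> u u0; apply: filterS (rc u0) => v ->.
- by move=> n; exact: mesh_bounds.
- by have := mesh_cvg0; rewrite -(cvg_shiftn n0).
- by move=> n; have [] := hk n.
Qed.

End SamplePath.

(** * The first-step equation *)

Section FirstStep.
Local Open Scope classical_set_scope.
Context d (Omega : measurableType d) (R : realType) (S : finType).
Context (q : S -> S -> R) (P : S -> probability Omega R) (Z : R -> Omega -> S).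
Context (hZ : is_CTMC q P Z).
Context (B : pred S) (a : S -> R) (s : R[i]) (y0 : S).
Context (a0 : forall x, 0 <= a x) (s0 : 0 <= complex.Re s).

Definition discounted_weight (w : Omega) : R[i] :=
  let theta := first_entrance (Z^~ w) B in
  cexp (- s * (Rintegral lebesgue_measure `[0, fine theta] (fun u => a (Z u w)))%:C) *
  (`[< (theta < +oo)%E /\ Z (fine theta) w = y0 >])%:R.

(** The boundary condition of the first-step equation: a chain already in [B] is stopped at once. *)
Definition boundary_value (F : S -> R[i]) (x : S) : R[i] :=
  if B x then (x == y0)%:R else F x.

Let sample n w i : S := Z (mesh R n * i%:R) w.
Let weight n w := total_weight (step_discount a s n) B y0 (sample n w).
Let v n x := cexpectation (P x) (weight n).

Let mesh_gt0 n : 0 < mesh R n.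
Proof. by have /andP[] := mesh_bounds R n. Qed.

Let discount1 n x : sqnorm (step_discount a s n x) <= 1.
Proof.
apply: sqnorm_cexp; rewrite Re_mul /= mulr0 subr0.
have -> : complex.Re (- s) = - complex.Re s by case: (s).
by rewrite mulNr oppr_le0 !mulr_ge0 // ltW.
Qed.

Let mchain n M :
  bounded_measurable (fun w => chain_weight (step_discount a s n) B y0 M (sample n w)).
Proof.
apply: bounded_measurable_chain_weight => i x; apply: (ctmc_measurable hZ).
by rewrite mulr_ge0 // ltW.
Qed.

Let v_lim n x : bounded_measurable (weight n) /\
  complex_cvg (fun M => chain_value (step_discount a s n) B y0
                          (transition P Z (mesh R n)) M x) (v n x).
Proof.
have [//|M w|w|mw cw] := @cexpectation_cvg _ _ _ (P x)
  (fun M w => chain_weight (step_discount a s n) B y0 M (sample n w)) (weight n).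
- by apply: sqnorm_chain_weight.
- exact: chain_weight_cvg.
split => //; move: cw.
under eq_fun do rewrite (cexpectation_chain_weight _ _ _ hZ (mesh_gt0 n)).
exact.
Qed.

(** The recursion [chain_valueS] relates horizons M+1 and M; letting M grow, both have the same
    limit, and uniqueness of limits gives the identity. *)
Let v_step n x : v n x = \sum_y (transition P Z (mesh R n) x y)%:C *
  (step_discount a s n y * boundary_value (v n) y).
Proof.
have [_ vx] := v_lim n x.
have vx1 := (complex_cvg_shift 1 _ _).2 vx.
apply: (complex_cvg_unique vx1).
under eq_fun do rewrite addn1 chain_valueS.
apply: complex_cvg_sum => y; apply: complex_cvgM; first exact: complex_cvg_cst.
apply: complex_cvgM; first exact: complex_cvg_cst.
rewrite /boundary_value; case: (B y); first exact: complex_cvg_cst.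
by have [] := v_lim n y.
Qed.

Let u y := boundary_value (fun y => cexpectation (P y) discounted_weight) y.

Let v_cvg y : complex_cvg (fun n => boundary_value (v n) y) (u y).
Proof.
rewrite /u /boundary_value; case: (B y); first exact: complex_cvg_cst.
have [n|n w|w|//] := @cexpectation_cvg _ _ _ (P y) weight discounted_weight.
- by have [] := v_lim n y.
- exact: sqnorm_total_weight.
by apply: total_weight_cvg => t t0; exact: (ctmc_right_continuous hZ).
Qed.

(* The generator equation is the one-step recursion [v_step] of the sampled chain
   divided by the mesh. *)
Lemma first_step_equation x : ~~ B x ->
  \sum_y (q x y)%:C * u y = s * (a x)%:C * u x.
Proof.
move=> xB; apply/eqP; rewrite -subr_eq0; apply/eqP.
have slope : complex_cvg (fun n => (mesh R n)^-1%:C * (step_discount a s n x - 1))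
    (- (s * (a x)%:C)).
  have := complex_cvg_cexp_slope (- (s * (a x)%:C)) mesh_gt0 (@mesh_cvg0 R).
  under eq_fun do rewrite -mulNr -mulrA -rmorphM.
  exact.
have rates y : complex_cvg (fun n =>
    ((transition P Z (mesh R n) x y - (x == y)%:R) / mesh R n)%:C) (q x y)%:C.
  apply: complex_cvg_real; have qxy := @ctmc_rates _ _ _ _ _ _ _ hZ x y.
  have mr : mesh R n @[n --> \oo] --> (0 : R)^'+.
    move=> A A0; have A1 : \forall n \near \oo, 0 < mesh R n -> A (mesh R n) :=
      @mesh_cvg0 R _ A0.
    by apply: filterS A1 => n; apply; exact: mesh_gt0.
  exact: cvg_comp mr qxy.
have discount_cvg y : complex_cvg (fun n => step_discount a s n y) 1.
  rewrite -cexp0; apply: complex_cvg_cexp.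
  have -> : 0 = - s * (a y * 0)%:C :> R[i] by rewrite !mulr0.
  apply: complex_cvgM; first exact: complex_cvg_cst.
  by apply: complex_cvg_real; apply: cvgM; [exact: cvg_cst|exact: mesh_cvg0].
(* With transition probabilities p, discount d, mesh h and stopped values g, [v_step] makes the sum
   over y of (p(x,y) - 1_{x=y})/h * d(y) * g(y), plus (d(x) - 1)/h * g(x), vanish for every n. Its
   limit is the difference of the two sides. *)
have lim0 := complex_cvgD
  (complex_cvg_sum (fun y =>
     complex_cvgM (rates y) (complex_cvgM (discount_cvg y) (v_cvg y))))
  (complex_cvgM slope (v_cvg x)).
have {lim0} : complex_cvg (fun=> 0) (\sum_y (q x y)%:C * (1 * u y) - s * (a x)%:C * u x).
  rewrite -mulNr; apply: complex_cvg_near lim0; apply: nearW => n.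
  have gx : boundary_value (v n) x = v n x by rewrite /boundary_value (negbTE xB).
  have dx : \sum_y (x == y)%:R%:C * (step_discount a s n y * boundary_value (v n) y) =
      step_discount a s n x * v n x.
    rewrite (bigD1 x) //= big1 ?addr0 => [|y yx]; first by rewrite eqxx mul1r gx.
    by rewrite eq_sym (negbTE yx) mul0r.
  rewrite gx.
  have -> : \sum_y ((transition P Z (mesh R n) x y - (x == y)%:R) / mesh R n)%:C *
      (step_discount a s n y * boundary_value (v n) y) =
      (mesh R n)^-1%:C * (v n x - step_discount a s n x * v n x).
    rewrite -dx v_step -sumrB mulr_sumr; apply: eq_bigr => y _.
    by rewrite rmorphM rmorphB /=; ring.
  ring.
under eq_bigr do rewrite mul1r.
by move=> /complex_cvg_unique; apply; exact: complex_cvg_cst.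
Qed.

End FirstStep.

(** * Block elimination *)

Section Elimination.
Context (F : fieldType) (dim : nat -> nat).

(** The one-level factorizations telescope, and the identity block at [l] matches the base case
    [pid_mx]. *)
Lemma descending_prod_eq (M : forall m, 'M[F]_(dim m.+1, dim m)) (l n : nat)
    (H : forall m, 'M[F]_(dim m, dim l)) : H l = 1%:M ->
  (forall m, (l <= m < n)%N -> H m.+1 = M m *m H m) ->
  (l <= n)%N -> descending_prod M n l = H n.
Proof.
move=> Hl; elim: n => [|n IHn] HM ln /=.
  by move: ln; rewrite leqn0 => /eqP l0; subst l; rewrite pid_mx_1.
case: ltnP => [nl|ln'].
  have l1 : l = n.+1 by lia.
  by subst l; rewrite pid_mx_1.
rewrite HM ?ln' ?leqnn // IHn // => m /andP[lm mn]; apply: HM; lia.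
Qed.

Lemma solve_unitmx (m p : nat) (V : 'M[F]_m) (X Y : 'M[F]_(m, p)) :
  V \in unitmx -> V *m X + Y = 0 -> X = - invmx V *m Y.
Proof.
move=> Vu /eqP; rewrite addr_eq0 => /eqP VX.
by rewrite mulNmx -mulmxN -VX mulKmx.
Qed.

Context (W : forall m, 'M[F]_(dim m)) (Q H : forall a b, 'M[F]_(dim a, dim b)).
Context (N l : nat).

(** The Schur complement left at level m after the levels above are eliminated: an upward step is
    followed by a return to m. *)
Let U m := W m + Q m m.+1 *m H m.+1 m.

(** Downward induction from N. The factorization at m+1 replaces [H m.+1 b] by [H m.+1 m *m H m b],
    so the equation at m becomes U H(m,b) + Q H(m-1,b) = 0. Solving it and taking b = m-1, where
    H(b,b) is the identity, identifies the coefficient as [H m m.-1], which is the factorization at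
    m. *)
Lemma tridiagonal_elimination :
  (forall b, (b <= N)%N -> H b b = 1%:M) ->
  (forall b, (l <= b < N)%N -> W N *m H N b + Q N N.-1 *m H N.-1 b = 0) ->
  (forall m b, (l <= b < m)%N -> (m < N)%N ->
     W m *m H m b + Q m m.+1 *m H m.+1 b + Q m m.-1 *m H m.-1 b = 0) ->
  W N \in unitmx -> (forall m, (l < m < N)%N -> U m \in unitmx) ->
  (l < N)%N ->
  [/\ forall m b, (l <= b < m)%N -> (m <= N)%N ->
        H m b = H m m.-1 *m H m.-1 b,
      H N N.-1 = - invmx (W N) *m Q N N.-1
    & forall m, (l < m < N)%N -> H m m.-1 = - invmx (U m) *m Q m m.-1].
Proof.
move=> H1 HN Hm WN Um lN.
have topE b : (l <= b < N)%N -> H N b = - invmx (W N) *m Q N N.-1 *m H N.-1 b.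
  by move=> lb; rewrite -mulmxA; apply: solve_unitmx; last exact: HN.
have top : H N N.-1 = - invmx (W N) *m Q N N.-1.
  by rewrite topE ?H1 ?mulmx1 //; lia.
(* The induction variable [i] is the distance of m from the top level. *)
have factor i m : (m + i)%N = N -> (l < m)%N ->
    (forall b, (l <= b < m)%N -> H m b = H m m.-1 *m H m.-1 b) /\
    ((m < N)%N -> H m m.-1 = - invmx (U m) *m Q m m.-1).
  elim: i m => [|i IHi] m miN lm.
    have mN : m = N by lia.
    subst m; split=> [b lb|]; last by rewrite ltnn.
    by rewrite topE // top.
  have mN : (m < N)%N by lia.
  have [IH _] := IHi m.+1 ltac:(lia) ltac:(lia).
  have mE b : (l <= b < m)%N -> H m b = - invmx (U m) *m Q m m.-1 *m H m.-1 b.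
    move=> lb; rewrite -mulmxA; apply: solve_unitmx; first by apply: Um; lia.
    by rewrite /U mulmxDl -(mulmxA (Q _ _)) -[X in _ + Q m m.+1 *m X]IH ?Hm //; lia.
  have mm : H m m.-1 = - invmx (U m) *m Q m m.-1.
    by rewrite mE ?H1 ?mulmx1 //; lia.
  by split => // b lb; rewrite mE // mm.
split=> // [m b lb mN|m /andP[lm mN]].
  have [fm _] := factor (N - m)%N m ltac:(lia) ltac:(lia); exact: fm.
by have [_] := factor (N - m)%N m ltac:(lia) lm; apply.
Qed.

End Elimination.

(** * Levels and phases: the first-step equation in block form *)

Section Levels.
Context (R : realType) (N : nat) (K : 'I_N.+1 -> nat).

(** A phase is a bare number and determines the state only once the level is known. *)
Lemma state_phaseP (b : 'I_N.+1) (j : 'I_(K b).+1) (y : state K) :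
  level y = b -> (phase y = j :> nat) <-> (y = st j).
Proof.
case: y => m i; rewrite /level /phase /= => mb; subst m.
split => [ij|]; first by congr (existT _ _ _); exact: val_inj.
by move=> /eqP; rewrite /st eq_Tagged /= => /eqP ->.
Qed.

Lemma sum_states (V : nmodType) (f : state K -> V) :
  \sum_y f y = \sum_l \sum_(i < (K l).+1) f (st i).
Proof.
rewrite sig_big_dep /=; apply: eq_bigr => -[m i] _ //.
Qed.

Lemma levK m : (m <= N)%N -> lev N m = m :> nat.
Proof. by move=> mN; rewrite inordK. Qed.

Context d (Omega : measurableType d).
Context (q : state K -> state K -> R) (hq : is_LDQBD_generator q).
Context (P : state K -> probability Omega R) (Z : R -> Omega -> state K).
Context (hZ : is_CTMC q P Z).
Context (c : state K -> R) (c0 : forall x, 0 <= c x).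
Context (A : {set 'I_N.+1}) (s : R[i]) (s0 : 0 <= complex.Re s).

Let a (x : state K) : R := c x * (level x \in A)%:R.
Let F (b : 'I_N.+1) (y0 x : state K) : R[i] :=
  cexpectation (P x) (discounted_weight Z (fun x => level x == b) a s y0).

Lemma LSTE (m b : 'I_N.+1) i j : LST P Z c A s m b i j = F b (st j) (st i).
Proof.
rewrite mxE; apply: (congr1 (cexpectation (P (st i)))); apply/funext => w.
rewrite /discounted_weight.
have -> : hitting_time Z b w = first_entrance (Z^~ w) (fun x => level x == b).
  rewrite /hitting_time /first_entrance; congr ereal_inf; congr image.
  by apply/funext => t; apply/propext; split=> -[? /eqP].
congr (_ * _%:R); congr nat_of_bool; apply/asbool_equiv_eq.
have rc u : 0 <= u -> (\forall v \near u^'+, Z v w = Z u w)%classic.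
  exact: (ctmc_right_continuous hZ).
(* At a finite hitting time the level is b by right-continuity, so prescribing the phase amounts to
   prescribing the state. *)
split=> -[th]; have [r -> [_ /eqP Br _]] := first_entrance_attained rc th.
  by move=> /(state_phaseP _ Br); split; rewrite ?ltry.
by move=> /(state_phaseP _ Br); split; rewrite ?ltry.
Qed.

(** The unknown of the block equations, with the identity as boundary block at m = b. *)
Definition boundary_LST (m b : 'I_N.+1) : 'M[R[i]]_((K m).+1, (K b).+1) :=
  \matrix_(i, j) boundary_value (fun x => level x == b) (st j) (F b (st j)) (st i).

Lemma boundary_LST_neq m b : m != b -> boundary_LST m b = LST P Z c A s m b.
Proof.
by move=> mb; apply/matrixP => i j; rewrite LSTE mxE /boundary_value /= (negbTE mb).
Qed.

Lemma boundary_LST_eq b : boundary_LST b b = 1%:M.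
Proof.
by apply/matrixP => i j; rewrite !mxE /boundary_value /= eqxx /st eq_Tagged.
Qed.

Lemma block_first_step (m b : 'I_N.+1) : m != b ->
  \sum_l Qblock q m l *m boundary_LST l b =
  ((s * Ind R A m) *: Cblock c m) *m boundary_LST m b.
Proof.
move=> mb; apply/matrixP => i j.
have a0 x : 0 <= a x by rewrite mulr_ge0.
have := @first_step_equation _ _ _ _ _ _ _ hZ (fun x => level x == b) a s
  (st j) a0 s0 (st i) mb.
rewrite -scalemxAl mul_diag_mx summxE !mxE sum_states => E.
transitivity (s * (a (st i))%:C *
  boundary_value (fun x => level x == b) (st j) (F b (st j)) (st i)).
  rewrite -E; apply: eq_bigr => l _; rewrite mxE; apply: eq_bigr => k _.
  by rewrite !mxE.
by rewrite /a rmorphM rmorph_nat /Ind /=; ring.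
Qed.

Lemma Qblock_skip (m l : 'I_N.+1) : (m + 1 < l)%N || (l + 1 < m)%N -> Qblock q m l = 0.
Proof.
by move=> ml; apply/matrixP => i j; rewrite !mxE (rate_skip_free hq).
Qed.

(** Skip-freeness leaves only the neighbouring levels in the block sum. The guard m < N excludes
    level N+1, for which [lev] would return a default level. *)
Lemma block_first_step_levels (m b : nat) : (b < m <= N)%N ->
  let Q (a b : nat) := Qblock q (lev N a) (lev N b) in
  let H (a b : nat) := boundary_LST (lev N a) (lev N b) in
  let D := (s * Ind R A (lev N m)) *: Cblock c (lev N m) in
  (Q m m - D) *m H m b +
  (if (m < N)%N then Q m m.+1 *m H m.+1 b else 0) + Q m m.-1 *m H m.-1 b = 0.
Proof.
move=> /andP[bm mN] Q H D.
have mb : lev N m != lev N b by rewrite -val_eqE /= !levK //; lia.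
rewrite mulmxBl -(block_first_step mb) (bigD1 (lev N m)) //=.
rewrite (bigD1 (lev N m.-1)) /=; last by rewrite -val_eqE /= !levK //; lia.
rewrite -/(Q m m) -/(H m b) -/(Q m m.-1) -/(H m.-1 b).
have -> : \sum_(l < N.+1 | (l != lev N m) && (l != lev N m.-1))
    Qblock q (lev N m) l *m boundary_LST l (lev N b) =
    if (m < N)%N then Q m m.+1 *m H m.+1 b else 0.
  case: ifP => mN'.
    rewrite (bigD1 (lev N m.+1)) /=; last by rewrite -!val_eqE /= !levK //; lia.
    rewrite big1 ?addr0 // => l; rewrite -!val_eqE /= !levK; [|lia..].
    by move=> ml; rewrite Qblock_skip ?mul0mx // !levK //; lia.
  rewrite big1 // => l; rewrite -!val_eqE /= !levK; [|lia..].
  have := ltn_ord l => lN ml.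
  by rewrite Qblock_skip ?mul0mx // !levK //; lia.
rewrite opprD addrA subrr add0r -addrA [X in _ + X]addrC; exact: addNr.
Qed.

End Levels.

Theorem lemma1 (R : realType) (N : nat) (K : 'I_N.+1 -> nat)
    (q : state K -> state K -> R) (hq : is_LDQBD_generator q)
    (d : measure_display) (Omega : measurableType d)
    (P : state K -> probability Omega R) (Z : R -> Omega -> state K)
    (hZ : is_CTMC q P Z)
    (c : state K -> R) (hc : forall x, 0 <= c x)
    (n k : nat) (hn : (1 <= n <= N)%N) (hk : (1 <= k <= n)%N)
    (A : {set 'I_N.+1}) (s : R[i]) (hs : 0 <= complex.Re s) :
  let C (a b : nat) := LST P Z c A s (lev N a) (lev N b) in
  let Q (a b : nat) := Qblock q (lev N a) (lev N b) in
  let D (a : nat) := (s * Ind R A (lev N a)) *: Cblock c (lev N a) in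
  let U_top := Q N N - D N in
  let U (m : nat) := Q m m - D m + Q m m.+1 *m C m.+1 m in
  U_top \in unitmx ->
  (forall m : nat, (n - k + 1 <= m <= N - 1)%N -> U m \in unitmx) ->
  [/\ C n (n - k)%N = descending_prod (fun m => C m.+1 m) n (n - k),
      C N N.-1 = - invmx U_top *m Q N N.-1
    & forall m : nat, (n - k + 1 <= m <= N - 1)%N ->
        C m m.-1 = - invmx (U m) *m Q m m.-1].
Proof.
move=> C Q D U_top U top_unit U_unit.
pose H (a b : nat) := boundary_LST P Z c A s (lev N a) (lev N b).
pose W (m : nat) := Q m m - D m.
have HC m b : (m <= N)%N -> (b < m)%N -> H m b = C m b.
  move=> mN bm; apply: (boundary_LST_neq hZ).
  by rewrite -val_eqE /= !levK //; lia.
have UE m : (m < N)%N -> U m = W m + Q m m.+1 *m H m.+1 m.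
  by move=> mN; rewrite HC.
(* Elimination is run with the target level n-k as lower end, so its pivots are exactly the matrices
   assumed invertible. *)
have [|b bN|m b bm mN||||H_factor H_top H_level] :=
  @tridiagonal_elimination _ (fun m => (K (lev N m)).+1) W Q H N (n - k).
- by move=> b _; exact: boundary_LST_eq.
- have := block_first_step_levels hq hZ hc A hs (m := N) (b := b); rewrite ltnn /= addr0.
  by apply; lia.
- have := block_first_step_levels hq hZ hc A hs (m := m) (b := b); rewrite mN.
  by apply; lia.
- exact: top_unit.
- by move=> m lm; rewrite -UE; [apply: U_unit|]; lia.
- lia.
split.
- rewrite -(HC n); [|lia..]; symmetry.
  apply: (@descending_prod_eq _ (fun m => (K (lev N m)).+1)
    (fun m => C m.+1 m) _ _ (fun m => H m (n - k)%N)).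
  + exact: boundary_LST_eq.
  + by move=> m lm; rewrite -HC; [apply: H_factor|..]; lia.
  + lia.
- by rewrite -H_top HC //; lia.
- move=> m lm; have mN : (m < N)%N by lia.
  have lmN : (n - k < m < N)%N by lia.
  rewrite (UE m mN) -(HC m m.-1); [exact: (H_level m lmN)|lia..].
Qed.
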